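(* For all integers $n \ge 1$ and $k \ge 0$, let $b_{n,k}$ be the sum of the binomial coefficients $\binom{\mathrm{des}(S) + \mathrm{asc}(T)}{k}$ over all intervals $S \le T$ of the Tamari lattice $\mathrm{Tam}(n)$. Then \[ b_{n,k} = \sum_{\ell = k}^{n-1} a_{n,\ell} \binom{\ell}{k} = \frac{2}{(3n+1)(3n+2)} \binom{n-1}{k} \binom{4n+1-k}{n+1}, \] where $a_{n,\ell}$ is the number of intervals $S \le T$ of $\mathrm{Tam}(n)$ with $\mathrm{des}(S) + \mathrm{asc}(T) = \ell$.
   Context: The Tamari lattice $\mathrm{Tam}(n)$ is the poset (a lattice) whose elements are the (rooted, plane) binary trees with $n$ nodes (each node has a possibly empty left subtree and a possibly empty right subtree), and whose cover relations are right rotations: $T'$ covers $T$ if $T'$ is obtained from $T$ by replacing a subtree of the form (node $j$ with left child $i$, where $i$ has subtrees $A,B$ and $j$ has right subtree $C$) by (node $i$ with left subtree $A$ and right child $j$, where $j$ has subtrees $B,C$). An interval of $\mathrm{Tam}(n)$ is a pair $(S,T)$ with $S \le T$. For a binary tree $T$, $\mathrm{des}(T)$ (resp. $\mathrm{asc}(T)$) is the number of binary trees covered by $T$ (resp. covering $T$) in the Tamari lattice. Equivalently, labelling the nodes of $T$ in inorder (recursively the left subtree, then the root, then the right subtree) and orienting the edges toward the root, $\mathrm{des}(T)$ (resp. $\mathrm{asc}(T)$) is the number of edges $i \to j$ between nodes with $i > j$ (resp. $i < j$). Binomial coefficients $\binom{a}{b}$ with $0\le a<b$ are $0$ (so the right-hand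 side vanishes for $k \ge n$). *)

(* Defs.v *)
From HB Require Import structures.
From mathcomp Require Import all_boot all_order all_algebra.
From mathcomp Require Import zify.

Set Implicit Arguments.
Unset Strict Implicit.
Unset Printing Implicit Defensive.

Inductive bintree : Type :=
| Empty
| Node of bintree & bintree.

Fixpoint nodes (t : bintree) : nat :=
  if t is Node l r then (nodes l + nodes r).+1 else 0.

Fixpoint bintree_encode (t : bintree) : GenTree.tree void :=
  if t is Node l r
  then GenTree.Node 1 [:: bintree_encode l; bintree_encode r]
  else GenTree.Node 0 [::].

Fixpoint bintree_decode (t : GenTree.tree void) : option bintree :=
  match t with
  | GenTree.Node 0 [::] => Some Empty
  | GenTree.Node 1 [:: l; r] =>
      if bintree_decode l is Some l' then
        if bintree_decode r is Some r' then Some (Node l' r') else None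
      else None
  | _ => None
  end.

Lemma bintree_encodeK : pcancel bintree_encode bintree_decode.
Proof. by elim=> [|l IHl r IHr] //=; rewrite IHl IHr. Qed.

HB.instance Definition _ := Countable.copy bintree (pcan_type bintree_encodeK).

(* [rotation s t]: replacing one subtree of [s], of the form
   [Node (Node a b) c], by [Node a (Node b c)] gives [t]. *)
Fixpoint rotation (s t : bintree) : bool :=
  match s, t with
  | Node l r, Node l' r' =>
      [|| if l is Node a b then (l' == a) && (r' == Node b r) else false,
          rotation l l' && (r == r')
        | (l == l') && rotation r r']
  | _, _ => false
  end.

Record tamari (n : nat) : Type :=
  Tamari { tree_of_tamari :> bintree; _ : nodes tree_of_tamari == n }.

HB.instance Definition _ n := [isSub for @tree_of_tamari n].
HB.instance Definition _ n := [Countable of tamari n by <:].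

Fixpoint bintrees_upto (h : nat) : seq bintree :=
  if h is h'.+1
  then Empty :: [seq Node l r | l <- bintrees_upto h', r <- bintrees_upto h']
  else [:: Empty].

Lemma bintrees_upto_uniq h : uniq (bintrees_upto h).
Proof.
elim: h => [|h IHh] //=; apply/andP; split.
  by apply/negP => /allpairsP[[l r] [_ _]].
by apply: allpairs_uniq => // -[l r] [l' r'] _ _ [-> ->].
Qed.

Lemma mem_bintrees_upto h t : nodes t <= h -> t \in bintrees_upto h.
Proof.
elim: h t => [|h IHh] [|l r] //= le_lr_h; rewrite inE /=.
apply: allpairs_f; apply: IHh.
  exact: leq_trans (leq_addr _ _) le_lr_h.
exact: leq_trans (leq_addl _ _) le_lr_h.
Qed.

Definition tamari_enum n : seq (tamari n) := pmap insub (bintrees_upto n).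

Lemma tamari_enum_uniq n : uniq (tamari_enum n).
Proof. exact/pmap_sub_uniq/bintrees_upto_uniq. Qed.

Lemma mem_tamari_enum n (t : tamari n) : t \in tamari_enum n.
Proof.
rewrite mem_pmap_sub; apply: mem_bintrees_upto.
by case: t => t /= /eqP ->.
Qed.

HB.instance Definition _ n := isFinite.Build (tamari n)
  (Finite.uniq_enumP (@tamari_enum_uniq n) (@mem_tamari_enum n)).

(* [covers t s]: [t] covers [s] in the Tamari lattice. *)
Definition covers n (t s : tamari n) : bool := rotation s t.

Definition tamari_le n : rel (tamari n) := connect (fun s t => covers t s).

(* The sum of the sizes of all right subtrees increases along rotations, which
   makes the reflexive-transitive closure of [covers] antisymmetric. *)
Fixpoint right_weight (t : bintree) : nat :=
  if t is Node l r then right_weight l + right_weight r + nodes r else 0.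

Lemma rotation_nodes s t : rotation s t -> nodes s = nodes t.
Proof.
elim: s t => [|l IHl r IHr] [|l' r'] //= /or3P[||].
- case: l {IHl} => // a b /andP[/eqP-> /eqP->] /=.
  by rewrite addnS addSn addnA.
- by case/andP=> /IHl-> /eqP->.
- by case/andP=> /eqP-> /IHr->.
Qed.

Lemma rotation_right_weight s t :
  rotation s t -> right_weight s < right_weight t.
Proof.
elim: s t => [|l IHl r IHr] [|l' r'] //= /or3P[||].
- case: l {IHl} => // a b /andP[/eqP-> /eqP->] /=.
  by lia.
- by case/andP=> /IHl lt_l /eqP->; rewrite !ltn_add2r.
- case/andP=> /eqP-> rot_r; rewrite (rotation_nodes rot_r) ltn_add2r.
  by rewrite ltn_add2l IHr.
Qed.

Lemma tamari_le_right_weight n (s t : tamari n) :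
  tamari_le s t -> s = t \/ right_weight s < right_weight t.
Proof.
case/connectP=> p; elim: p s => [|u p IHp] s /=; first by left.
case/andP=> /rotation_right_weight lt_su path_p def_t; right.
by case: (IHp u path_p def_t) => [<-|/(ltn_trans lt_su)].
Qed.

Lemma tamari_le_refl n : reflexive (@tamari_le n).
Proof. exact: connect0. Qed.

Lemma tamari_le_anti n : antisymmetric (@tamari_le n).
Proof.
move=> s t /andP[/tamari_le_right_weight[//|lt_st]].
by case/tamari_le_right_weight=> [//|/(ltn_trans lt_st)]; rewrite ltnn.
Qed.

Lemma tamari_le_trans n : transitive (@tamari_le n).
Proof. exact: connect_trans. Qed.

Fact tamari_display : Order.disp_t. Proof. exact: Order.Disp tt tt. Qed.

HB.instance Definition _ n := Order.Le_isPOrder.Build tamari_display (tamari n)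
  (@tamari_le_refl n) (@tamari_le_anti n) (@tamari_le_trans n).

Definition des n (t : tamari n) : nat := #|[set s : tamari n | covers t s]|.
Definition asc n (t : tamari n) : nat := #|[set s : tamari n | covers s t]|.

Definition intervals n : {set tamari n * tamari n} :=
  [set I | (I.1 <= I.2)%O].

Definition a_ (n l : nat) : nat :=
  #|[set I in intervals n | des I.1 + asc I.2 == l]|.

Definition b_ (n k : nat) : nat :=
  \sum_(I in intervals n) 'C(des I.1 + asc I.2, k).

(* Main.v *)
Require Import Defs.
From mathcomp Require Import all_boot all_order all_algebra.
From mathcomp Require Import zify ring.

Set Implicit Arguments.
Unset Strict Implicit.
Unset Printing Implicit Defensive.

(** The statistics des and asc count right and left edges, and an interval
whose upper tree is [Node l r] splits into an interval below [l], an interval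
below [r], and a place on the left branch of the lower tree of the second
one: there a new node is inserted, which carries the lower tree of the first one
as its left subtree ([tamari_le_lower]).  Let [F] be the generating function of
intervals [s <= t], where [tau] marks the nodes, [z] marks [des s + asc t], and
the indeterminate [X] marks the length of the left branch of [s].  The splitting gives ([interval_gfS])

  (X - 1)(F - 1) = tau X (1 + z(F - 1)) ((X - 1)F + z(F - F(1))),

an equation with one catalytic variable, solved by the kernel method
([catalytic_solution]).  There is a series [u] such that the derivative of the
equation with respect to [F] vanishes at [X = u].  Then so does its partial derivative
with respect to [X], and these equations turn into [u - 1 = z (F(u) - 1)].
Hence [y = u - 1] and [F(1)] satisfy

  y = tau (1 + y)^3 (y + z),    z^2 F(1) = (y + z)(z - y^2).

Lagrange inversion ([lagrange_inversion]) expresses the coefficients of [F(1)]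
through those of [((1 + y)^3 (y + z))^n], and adding a total derivative
([coef_total_derivative]) turns the outcome into

  (3n+1)(3n+2) [tau^n] F(1) = 2 [y^(n+1)] (1 + y)^(3n+2) (y + z)^(n-1).

At [z = q + 1] the left-hand coefficient is the sum over [k] of
[b_ n k * q ^ k], and expanding the right-hand side in powers of [q] gives the
closed form.

Power series in [tau] are replaced by elements of a commutative ring in which
[tau] is nilpotent.  Fixed-point equations [x = a + tau p(x)] are solvable
there, and [x = tau c x] forces [x = 0]: nothing else is used of series.  The
ring is the truncated polynomial ring in [y], where [tau] is
[y / ((1 + y)^3 (y + z))].  In it the catalytic equation holds exactly for a sum
over the finitely many trees of bounded height. *)

(** * Ascents and descents count edges *)

(** Moves sums over the finite type [tamari n] to sums over explicit lists of
bare trees, which can be computed by recursion on trees. *)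
Lemma big_tamari n (L : seq bintree) (F : bintree -> nat) :
    uniq L -> {in L, forall s, nodes s = n} ->
  \sum_(s : tamari n | tree_of_tamari s \in L) F s = \sum_(s <- L) F s.
Proof.
move=> uL nL; rewrite -(big_map (@tree_of_tamari n) (mem L) F) -big_filter.
apply: perm_big; apply: uniq_perm => //.
  by rewrite filter_uniq // (map_inj_uniq val_inj) index_enum_uniq.
move=> s; rewrite mem_filter; apply: andb_idr => sL.
have ns : nodes s == n by rewrite nL.
by apply/mapP; exists (Tamari ns); rewrite ?mem_index_enum.
Qed.

Fixpoint right_edges (t : bintree) : nat :=
  if t is Node l r then right_edges l + right_edges r + (r != Empty) else 0.

Fixpoint left_edges (t : bintree) : nat :=
  if t is Node l r then left_edges l + left_edges r + (l != Empty) else 0.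

Fixpoint lower_covers (t : bintree) : seq bintree :=
  if t is Node l r then
    (if r is Node b c then [:: Node (Node l b) c] else [::])
    ++ [seq Node l' r | l' <- lower_covers l]
    ++ [seq Node l r' | r' <- lower_covers r]
  else [::].

Fixpoint upper_covers (t : bintree) : seq bintree :=
  if t is Node l r then
    (if l is Node a b then [:: Node a (Node b r)] else [::])
    ++ [seq Node l' r | l' <- upper_covers l]
    ++ [seq Node l r' | r' <- upper_covers r]
  else [::].

Lemma Node_eq a b c d : (Node a b == Node c d) = (a == c) && (b == d).
Proof. by apply/eqP/andP => [[-> ->]|[/eqP-> /eqP->]]. Qed.

Lemma mem_map_Nodel r l' r' L :
  (Node l' r' \in [seq Node l r | l <- L]) = (l' \in L) && (r' == r).
Proof.
apply/mapP/andP => [[l lL [-> ->]]|[lL /eqP->]]; first by rewrite eqxx.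
by exists l'.
Qed.

Lemma mem_map_Noder l l' r' R :
  (Node l' r' \in [seq Node l r | r <- R]) = (l' == l) && (r' \in R).
Proof.
apply/mapP/andP => [[r rL [-> ->]]|[/eqP-> rL]]; first by rewrite eqxx.
by exists r'.
Qed.

Lemma mem_lower_covers s t : (s \in lower_covers t) = rotation s t.
Proof.
elim: t s => [|l IHl r IHr] [|l' r'] /=; rewrite ?in_nil //.
  by rewrite !mem_cat; apply/negbTE; rewrite !negb_or; apply/and3P; split;
    [case: (r) | apply/mapP=> -[] | apply/mapP=> -[]].
rewrite !mem_cat mem_map_Nodel mem_map_Noder IHl IHr [r' == r]eq_sym.
congr (_ || _); case: r {IHr} => [|b c]; case: l' => [|a b'] //=.
- by rewrite andbF.
- by rewrite inE !Node_eq [a == l]eq_sym [b' == b]eq_sym [r' == c]eq_sym andbA.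
Qed.

Lemma mem_upper_covers s t : (s \in upper_covers t) = rotation t s.
Proof.
elim: t s => [|l IHl r IHr] [|l' r'] /=; rewrite ?in_nil //.
  by rewrite !mem_cat; apply/negbTE; rewrite !negb_or; apply/and3P; split;
    [case: (l) | apply/mapP=> -[] | apply/mapP=> -[]].
rewrite !mem_cat mem_map_Nodel mem_map_Noder IHl IHr [r == r']eq_sym.
rewrite [l == l']eq_sym.
congr (_ || _); case: l {IHl} => [|a b] //=.
by rewrite inE !Node_eq.
Qed.

Lemma rotation_irrefl t : rotation t t = false.
Proof. by apply/negP => /rotation_right_weight; rewrite ltnn. Qed.

Lemma uniq_rotations l r L R :
    uniq L -> uniq R -> l \notin L ->
  uniq ([seq Node l' r | l' <- L] ++ [seq Node l r' | r' <- R]).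
Proof.
move=> uL uR lL; rewrite cat_uniq !map_inj_uniq ?uL ?uR ?andbT //=.
- by apply/hasPn => _ /mapP[r' _ ->]; rewrite mem_map_Nodel (negbTE lL).
- by move=> ? ? [].
- by move=> ? ? [].
Qed.

Lemma uniq_lower_covers t : uniq (lower_covers t).
Proof.
elim: t => //= l IHl r IHr.
rewrite cat_uniq uniq_rotations ?mem_lower_covers ?rotation_irrefl // andbT.
case: r {IHr} => [|b c] //=; rewrite ?andbT; first exact/hasPn.
apply/hasPn => -[|l' r']; rewrite inE ?Node_eq //.
rewrite mem_cat mem_map_Nodel mem_map_Noder mem_lower_covers => nl.
apply/negP => /andP[/eqP def_l' _]; case/orP: nl; subst l'.
  by case/andP=> /rotation_nodes /=; lia.
by case/andP => /eqP def_l _; have /= := congr1 nodes def_l; lia.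
Qed.

Lemma uniq_upper_covers t : uniq (upper_covers t).
Proof.
elim: t => //= l IHl r IHr.
rewrite cat_uniq uniq_rotations ?mem_upper_covers ?rotation_irrefl // andbT.
case: l {IHl} => [|a b] //=; rewrite ?andbT; first exact/hasPn.
apply/hasPn => -[|l' r']; rewrite inE ?Node_eq //.
rewrite mem_cat mem_map_Nodel mem_map_Noder mem_upper_covers => nl.
apply/negP => /andP[/eqP def_l' _]; case/orP: nl; subst l'.
  rewrite -[X in _ \in X]/(upper_covers (Node a b)) mem_upper_covers.
  by case/andP=> /rotation_nodes /=; lia.
by case/andP => /eqP def_l _; have /= := congr1 nodes def_l; lia.
Qed.

Lemma size_lower_covers t : size (lower_covers t) = right_edges t.
Proof.
elim: t => //= l IHl r IHr; rewrite !size_cat !size_map IHl IHr addnC.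
by case: r {IHr}.
Qed.

Lemma size_upper_covers t : size (upper_covers t) = left_edges t.
Proof.
elim: t => //= l IHl r IHr; rewrite !size_cat !size_map IHl IHr addnC.
by case: l {IHl}.
Qed.

Lemma nodes_tamari n (t : tamari n) : nodes t = n.
Proof. by case: t => t /= /eqP. Qed.

Lemma desE n (t : tamari n) : des t = right_edges t.
Proof.
rewrite /des -size_lower_covers cardsE -sum1_card -sum1_size.
rewrite -(@big_tamari n _ (fun=> 1)) ?uniq_lower_covers //.
  by apply: eq_bigl => s; rewrite mem_lower_covers.
by move=> s; rewrite mem_lower_covers => /rotation_nodes ->; apply: nodes_tamari.
Qed.

Lemma ascE n (t : tamari n) : asc t = left_edges t.
Proof.
rewrite /asc -size_upper_covers cardsE -sum1_card -sum1_size.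
rewrite -(@big_tamari n _ (fun=> 1)) ?uniq_upper_covers //.
  by apply: eq_bigl => s; rewrite mem_upper_covers.
by move=> s; rewrite mem_upper_covers => /rotation_nodes <-; apply: nodes_tamari.
Qed.

Lemma right_left_edges t :
  right_edges t + left_edges t = (nodes t).-1.
Proof.
elim: t => //= l IHl r IHr.
by case: l r IHl IHr => [|l1 l2] [|r1 r2] /=; rewrite ?eqxx /=; lia.
Qed.

(** A rotation may create a right edge, when the middle subtree is empty, but
never destroys one; hence descents increase along the order. *)
Lemma rotation_right_edges s t :
  rotation s t -> right_edges s <= right_edges t.
Proof.
elim: s t => [|l IHl r IHr] [|l' r'] //= /or3P[||].
- by case: l {IHl} => // a b /andP[/eqP-> /eqP->] /=; case: (b == _); lia.
- by case/andP=> /IHl lt_l /eqP->; rewrite !leq_add2r.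
- case/andP=> /eqP-> rot_r; have := IHr _ rot_r.
  by case: r r' rot_r {IHr} => [|? ?] [|? ?] //=; lia.
Qed.

(** * The recursive description of Tamari intervals *)

(** The trees obtained from [x] by inserting a node with left subtree [s] on
the left branch of [x]: the part of the branch below the insertion point becomes
the right subtree of the new node. *)
Fixpoint hang (s x : bintree) : seq bintree :=
  Node s x :: (if x is Node l r then [seq Node l' r | l' <- hang s l] else [::]).

(** The Tamari ideal below [t]. In a tree below [Node l r], the node that
corresponds to the root still lies on the left branch.  Its left subtree is
below [l], and splicing out the node with this subtree (its right subtree takes
its place) leaves a tree below [r]. *)
Fixpoint lower (t : bintree) : seq bintree :=
  if t is Node l r
  then [seq u | p <- [seq (s, x) | s <- lower l, x <- lower r], u <- hang p.1 p.2]
  else [:: Empty].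

(** The Tamari order on trees without a fixed number of nodes, as recursion on
subtrees requires. *)
Inductive below : bintree -> bintree -> Prop :=
| below_refl t : below t t
| below_step s u t of rotation s u & below u t : below s t.

Lemma below_trans s u t : below s u -> below u t -> below s t.
Proof. by elim=> // s1 u1 t1 rot _ IH /IH; apply: below_step. Qed.

Lemma below_Node l l' r r' :
  below l l' -> below r r' -> below (Node l r) (Node l' r').
Proof.
move=> le_l le_r; apply: (@below_trans _ (Node l' r)).
  elim: le_l => [t|s u t rot _ IH]; first exact: below_refl.
  by apply: below_step IH; rewrite /= rot eqxx orbT.
elim: le_r => [t|s u t rot _ IH]; first exact: below_refl.
by apply: below_step IH; rewrite /= rot eqxx !orbT.
Qed.

Lemma below_nodes s t : below s t -> nodes s = nodes t.
Proof. by elim=> // s1 u1 t1 /rotation_nodes ->. Qed.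

Lemma below_right_edges s t : below s t -> right_edges s <= right_edges t.
Proof. by elim=> // s1 u1 t1 /rotation_right_edges le_su _; apply: leq_trans. Qed.

Lemma nodes_hang u s x : u \in hang s x -> nodes u = (nodes s + nodes x).+1.
Proof.
elim: x u => [|l IHl r _] u; rewrite /= in_cons => /orP[/eqP-> //|] //.
by case/mapP=> v /IHl /= eq_v ->; rewrite /= eq_v; lia.
Qed.

(** The size of [s] singles out the inserted node: left subtrees along a left
branch have distinct sizes. *)
Lemma hang_inj u s x s' x' :
    u \in hang s x -> u \in hang s' x' -> nodes s = nodes s' ->
  s = s' /\ x = x'.
Proof.
move=> us us' eq_s; elim: x u us x' us' => [|l IHl r _] u us [|l' r'] us'.
- by move: us us'; rewrite !inE => /eqP-> /eqP[].
- by have:= nodes_hang us; have:= nodes_hang us' => /=; lia.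
- by have:= nodes_hang us; have:= nodes_hang us' => /=; lia.
move: us us'; rewrite !inE => /orP[/eqP->|/mapP[v vl ->]].
  case/orP=> [/eqP[-> -> ->] //|/mapP[v /nodes_hang eq_v [def_s]]].
  by move: eq_s; rewrite def_s eq_v; lia.
case/orP=> [/eqP[def_s' _]|/mapP[v' v'l [def_v ->]]].
  by have:= nodes_hang vl; rewrite def_s'; lia.
by rewrite -def_v in v'l; have [-> ->] := IHl _ vl _ v'l.
Qed.

Lemma uniq_hang s x : uniq (hang s x).
Proof.
elim: x => //= l IHl r _; rewrite map_inj_uniq ?IHl ?andbT; last by move=> ? ? [].
by apply/mapP=> -[v /nodes_hang eq_v [def_s]]; move: eq_v; rewrite -def_s; lia.
Qed.

Lemma lowerP u l r :
  reflect (exists s x, [/\ s \in lower l, x \in lower r & u \in hang s x])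
          (u \in lower (Node l r)).
Proof.
apply: (iffP allpairsPdep).
  case=> -[_ _] [v [/allpairsP[[s x] [/= sl xr [-> ->]]] /= vh ->]].
  by exists s, x.
case=> s [x [sl xr uh]]; exists (s, x), u; split=> //.
by apply/allpairsP; exists (s, x).
Qed.

Lemma lower_refl t : t \in lower t.
Proof.
elim: t => // l IHl r IHr; apply/lowerP; exists l, r; split=> //.
by case: (r) => *; apply: mem_head.
Qed.

Lemma hang_below u s x : u \in hang s x -> below u (Node s x).
Proof.
elim: x u => [|l IHl r _] u; rewrite /= inE.
  by move/eqP->; apply: below_refl.
case/orP=> [/eqP->|/mapP[v /IHl le_v ->]]; first exact: below_refl.
apply: below_trans (below_Node le_v (below_refl r)) _.
by apply: below_step (below_refl _); rewrite /= !eqxx.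
Qed.

Lemma lower_below s t : s \in lower t -> below s t.
Proof.
elim: t s => [|l IHl r IHr] s.
  by rewrite inE => /eqP->; apply: below_refl.
case/lowerP=> s' [x [/IHl le_s /IHr le_x /hang_below le_u]].
exact: below_trans le_u (below_Node le_s le_x).
Qed.

(** The heart of the description of ideals: an inverse rotation of an inserted
tree takes place inside [s], or inside [x], or slides the insertion point one
step down the left branch, possibly after an inverse rotation of [x] that
lengthens this branch. *)
Lemma hang_rotation v u s x : rotation v u -> u \in hang s x ->
  exists s0 x0, [/\ s0 = s \/ rotation s0 s, x0 = x \/ rotation x0 x
                  & v \in hang s0 x0].
Proof.
have hangE s1 x1 : Node s1 x1 \in hang s1 x1.
  by case: x1 => *; apply: mem_head.
elim: x u v => [|l IHl r _] u [|v1 v2]; rewrite /= inE.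
- by case: u.
- move=> + /eqP def_u; rewrite def_u /=.
  case/or3P=> [|/andP[rot /eqP->]|/andP[_]].
  + by case: (v1) => // ? ? /andP[_ /eqP].
  + by exists v1, Empty; split; [right | left | apply: hangE].
  + by case: (v2).
- by case: u.
move=> + /orP[/eqP def_u|/mapP[w wl def_u]]; rewrite def_u /=.
  case/or3P=> [|/andP[rot /eqP->]|/andP[/eqP-> rot]].
  - case: v1 => // a b /andP[/eqP<- /eqP[-> ->]].
    exists s, (Node b v2); split; [by left | by left |].
    by rewrite inE; apply/orP; right; apply: map_f; apply: hangE.
  - by exists v1, (Node l r); split; [right | left | apply: hangE].
  - by exists s, v2; split; [left | right | apply: hangE].
case/or3P=> [|/andP[rot /eqP->]|/andP[/eqP-> rot]].
- case: v1 => // a b /andP[/eqP<- /eqP->].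
  exists s, (Node (Node l b) v2); split; [by left | right |].
    by rewrite /= !eqxx.
  by rewrite inE map_f ?orbT //= inE map_f ?orbT.
- have [s0 [l0 [def_s def_l v0]]] := IHl _ _ rot wl.
  exists s0, (Node l0 r); split=> //.
    by case: def_l => [->|rot_l]; [left | right; rewrite /= rot_l eqxx orbT].
  by rewrite inE map_f ?orbT.
- exists s, (Node l v2); split; [by left | right |].
    by rewrite /= rot eqxx !orbT.
  by rewrite inE map_f ?orbT.
Qed.

Lemma rotation_lower v u t : rotation v u -> u \in lower t -> v \in lower t.
Proof.
elim: t v u => [|l IHl r IHr] v u rot.
  by rewrite inE => /eqP def_u; move: rot; rewrite def_u; case: v.
case/lowerP=> s [x [sl xr uh]].
have [s0 [x0 [def_s def_x vh]]] := hang_rotation rot uh.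
apply/lowerP; exists s0, x0; split=> //.
  by case: def_s => [->//|rot_s]; apply: IHl rot_s sl.
by case: def_x => [->//|rot_x]; apply: IHr rot_x xr.
Qed.

Lemma below_lower s t : below s t -> s \in lower t.
Proof.
by elim=> [t1|s1 u t1 rot _ ut]; [apply: lower_refl | apply: rotation_lower ut].
Qed.

Lemma uniq_lower t : uniq (lower t).
Proof.
elim: t => //= l IHl r IHr; apply: allpairs_uniq_dep.
- by apply: allpairs_uniq => // -[? ?] [? ?] _ _ [-> ->].
- by move=> p _; apply: uniq_hang.
have nl s : s \in lower l -> nodes s = nodes l by move/lower_below/below_nodes.
move=> p q /allpairsPdep[p1 [u [+ uh def_p]]].
case/allpairsP=> -[s x] [/= /nl ns _ def_p1].
case/allpairsPdep=> [q1 [u' [+ u'h def_q]]].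
case/allpairsP=> -[s' x'] [/= /nl ns' _ def_q1].
subst p1 q1; rewrite def_p def_q /= in uh u'h * => eq_u; subst u'.
by have [-> ->] := hang_inj uh u'h (etrans ns (esym ns')).
Qed.

Lemma tamari_le_lower n (s t : tamari n) :
  (s <= t)%O = (tree_of_tamari s \in lower t).
Proof.
apply/idP/idP=> [/connectP[p]|/lower_below].
  elim: p s => [|u p IHp] s /=; first by move=> _ ->; apply: lower_refl.
  by case/andP=> rot /IHp{}IHp /IHp; apply: rotation_lower rot.
move=> le_st; have: below (tree_of_tamari s) t by [].
move def_s1: (tree_of_tamari s) => s1; move def_t1: (tree_of_tamari t) => t1.
move=> {}le_st; elim: le_st s t def_s1 def_t1 => [t2|s2 u2 t2 rot le_ut IH] s t.
  by move=> def_s def_t; rewrite (_ : s = t) //; apply: val_inj; rewrite /= def_s.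
move=> def_s def_t; have nu : nodes u2 == n.
  by rewrite (below_nodes le_ut) -def_t nodes_tamari.
apply: connect_trans (IH (Tamari nu) t erefl def_t).
by apply: connect1; rewrite /covers def_s.
Qed.

Import GRing.Theory Num.Theory.
Local Open Scope ring_scope.

(** * The catalytic equation *)

Fixpoint left_branch (t : bintree) : nat :=
  if t is Node l r then (left_branch l).+1 else 0.

Section GeneratingFunction.

Variables (A : comNzRingType) (z tau : A).

(** The weight splits as [lower_wt] for the lower tree and [upper_wt] for the
upper tree; only the left branch of the lower tree needs the catalytic
indeterminate. *)
Definition lower_wt (s : bintree) : {poly A} :=
  (z ^+ right_edges s)%:P * 'X^(left_branch s).

Definition lower_gf (t : bintree) : {poly A} := \sum_(s <- lower t) lower_wt s.

Definition upper_wt (t : bintree) : A := tau ^+ nodes t * z ^+ left_edges t.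

Definition interval_gf (h : nat) : {poly A} :=
  \sum_(t <- bintrees_upto h) (upper_wt t)%:P * lower_gf t.

(** The insertion points yield the powers of ['X] from [1] to
[(left_branch x).+1], on top of the left branch of [s], and all but the last one
create a right edge.  The factor ['X - 1] sums this geometric progression
without division. *)
Lemma hang_gf s x :
  ('X - 1) * (\sum_(u <- hang s x) lower_wt u)
  = 'X * lower_wt s
    * (('X - 1) * lower_wt x + z%:P * (lower_wt x - (lower_wt x).[1]%:P)).
Proof.
have wt_Node l r : lower_wt (Node l r)
    = (z ^+ (right_edges r + (r != Empty)))%:P * 'X * lower_wt l.
  rewrite /lower_wt /= exprS -addnA exprD polyCM; ring.
have wt1 t : (lower_wt t).[1] = z ^+ right_edges t.
  by rewrite /lower_wt hornerM hornerC hornerXn expr1n mulr1.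
elim: x => [|l IHl r _].
  rewrite /= big_seq1 wt_Node /= wt1 /lower_wt /= expr0 mulr1 subrr; ring.
rewrite [hang _ _]/= big_cons big_map mulrDr.
under eq_bigr do rewrite wt_Node.
rewrite -mulr_sumr [X in _ + X]mulrCA IHl !wt1 !wt_Node /= addn1 exprS.
rewrite -[(_ + right_edges r + _)%N]addnA exprD !polyCM.
ring.
Qed.

Lemma lower_gf_Node l r :
  ('X - 1) * lower_gf (Node l r)
  = 'X * lower_gf l
    * (('X - 1) * lower_gf r + z%:P * (lower_gf r - (lower_gf r).[1]%:P)).
Proof.
rewrite /lower_gf /= big_allpairs_dep big_allpairs /=.
rewrite horner_sum rmorph_sum /= -sumrB !mulr_sumr -big_split /=.
rewrite mulr_suml; apply: eq_bigr => s _.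
by rewrite !mulr_sumr; apply: eq_bigr => x _; rewrite hang_gf.
Qed.

(** The factor [1 + z (F - 1)] is the series of left subtrees of the upper
tree: a left edge, hence a [z], appears unless the subtree is empty. *)
Lemma interval_gfS h :
  let F := interval_gf h in
  ('X - 1) * (interval_gf h.+1 - 1)
  = tau%:P * 'X * (1 + z%:P * (F - 1))
    * (('X - 1) * F + z%:P * (F - F.[1]%:P)).
Proof.
move=> F.
have gf_Empty : (upper_wt Empty)%:P * lower_gf Empty = 1.
  by rewrite /lower_gf big_seq1 /upper_wt /lower_wt /= !expr0 !mulr1.
have left_gf : 1 + z%:P * (F - 1)
    = \sum_(l <- bintrees_upto h)
        (z ^+ (l != Empty) * upper_wt l)%:P * lower_gf l.
  have [L [def_L nL]] : exists L, bintrees_upto h = Empty :: L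
      /\ {in L, forall t, t != Empty}.
    case: h {F} => [|h]; first by exists [::]; split=> // t; rewrite in_nil.
    exists [seq Node l r | l <- bintrees_upto h, r <- bintrees_upto h].
    by split=> // _ /allpairsP[[? ?] [_ _ ->]].
  rewrite /F /interval_gf def_L !big_cons mul1r gf_Empty; congr (_ + _).
  rewrite addrAC subrr add0r mulr_sumr; apply: eq_big_seq => t /nL->.
  by rewrite expr1 [(z * _)%:P]polyCM mulrA.
have right_gf : ('X - 1) * F + z%:P * (F - F.[1]%:P)
    = \sum_(r <- bintrees_upto h) (upper_wt r)%:P *
        (('X - 1) * lower_gf r + z%:P * (lower_gf r - (lower_gf r).[1]%:P)).
  rewrite /F /interval_gf horner_sum rmorph_sum /= -sumrB !mulr_sumr.
  rewrite -big_split /=; apply: eq_bigr => r _.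
  by rewrite hornerM hornerC [(upper_wt r * _)%:P]polyCM; ring.
rewrite left_gf right_gf /interval_gf [bintrees_upto _]/= big_cons gf_Empty.
rewrite addrAC subrr add0r big_allpairs_dep -[RHS]mulrA mulr_suml.
rewrite [LHS]mulr_sumr [RHS]mulr_sumr.
apply: eq_bigr => l _; rewrite [LHS]mulr_sumr [RHS]mulrA [RHS]mulr_sumr.
apply: eq_bigr => r _.
rewrite [LHS]mulrCA lower_gf_Node /upper_wt /= exprS !exprD !polyCM; ring.
Qed.

(** The trees of [bintrees_upto h.+1] that are not in [bintrees_upto h] have
more than [h] nodes. *)
Lemma interval_gf_stable h :
  tau ^+ h.+1 = 0 -> interval_gf h.+1 = interval_gf h.
Proof.
move=> nil_tau.
have trunc k : interval_gf k
    = \sum_(t <- bintrees_upto k | (nodes t <= h)%N) (upper_wt t)%:P * lower_gf t.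
  rewrite /interval_gf [RHS]big_mkcond; apply: eq_bigr => t _.
  case: leqP => // lt_h_t; rewrite /upper_wt -(subnKC lt_h_t) exprD nil_tau.
  by rewrite !mul0r.
rewrite !trunc -big_filter -[RHS]big_filter; apply: perm_big.
apply: uniq_perm; rewrite ?filter_uniq ?bintrees_upto_uniq // => t.
rewrite !mem_filter; apply: andb_id2l => le_t.
by rewrite !mem_bintrees_upto // (leq_trans le_t).
Qed.

End GeneratingFunction.

(** * The kernel method over a ring with a nilpotent parameter *)

Lemma nilpotent_contraction (A : comNzRingType) (tau c x : A) N :
  tau ^+ N = 0 -> x = tau * c * x -> x = 0.
Proof.
move=> nil_tau def_x.
have iter k : x = (tau * c) ^+ k * x.
  by elim: k => [|k IHk]; rewrite ?expr0 ?mul1r // exprSr -mulrA -def_x.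
by rewrite (iter N) exprMn nil_tau !mul0r.
Qed.

Lemma horner_sub_dvd (A : comNzRingType) (p : {poly A}) (x y : A) :
  exists c, p.[x] - p.[y] = c * (x - y).
Proof.
elim/poly_ind: p => [|p a [c def_c]].
  by exists 0; rewrite !horner0 subrr mul0r.
exists (c * x + p.[y]); rewrite !hornerMXaddC.
have -> : p.[x] = c * (x - y) + p.[y] by rewrite -def_c subrK.
ring.
Qed.

(** The iterates of [x |-> a + tau * p.[x]] agree modulo higher and higher
powers of [tau], so they are eventually constant. *)
Lemma nilpotent_fixpoint (A : comNzRingType) (tau a : A) (p : {poly A}) N :
  tau ^+ N = 0 -> exists x, x = a + tau * p.[x].
Proof.
move=> nil_tau; pose step x := a + tau * p.[x]; pose x k := iter k step a.
have conv k : exists c, x k.+1 - x k = tau ^+ k * c.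
  elim: k => [|k [c def_c]]; first by eexists; rewrite expr0 mul1r.
  have [d def_d] := horner_sub_dvd p (x k.+1) (x k).
  exists (d * c); rewrite /= /step -/(x k) -/(x k.+1).
  rewrite opprD addrACA subrr add0r -mulrBr def_d def_c exprS; ring.
have [c def_c] := conv N; exists (x N); apply/eqP.
by rewrite -subr_eq0 -oppr_eq0 opprB; move: def_c => /= ->; rewrite nil_tau mul0r.
Qed.

(** The last step of the kernel method needs a cancellation by [tau], which is
not possible in a ring where [tau] is nilpotent; hence the factor [tau] in the
conclusion. *)
Lemma catalytic_solution (A : comNzRingType) (z tau y : A) (F : {poly A}) N :
    tau ^+ N = 0 ->
    ('X - 1) * (F - 1)
      = tau%:P * 'X * (1 + z%:P * (F - 1))
        * (('X - 1) * F + z%:P * (F - F.[1]%:P)) ->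
    y = tau * ((1 + y) ^+ 3 * (y + z)) ->
  tau * (z ^+ 2 * F.[1]) = tau * ((y + z) * (z - y ^+ 2)).
Proof.
move=> nil_tau eqF def_y; pose g := F.[1].
pose X := 1 + z%:P * (F - 1).
pose W := ('X - 1) * F + z%:P * (F - g%:P).
(* The root [u] of the derivative of the equation with respect to [F]. *)
have [u def_u] := @nilpotent_fixpoint A tau 1
  ('X * (z%:P * W + X * ('X - 1 + z%:P))) N nil_tau.
pose v := F.[u]; pose d := (F^`()).[u]; pose x := 1 + z * (v - 1).
pose w := (u - 1) * v + z * (v - g).
have eP : (u - 1) * (v - 1) = tau * u * x * w.
  have /(congr1 (horner^~ u)) := eqF.
  by rewrite /= !hornerE.
have eK : u - 1 = tau * (u * (z * w + x * (u - 1 + z))).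
  by rewrite {1}def_u addrAC subrr add0r /X /W !hornerE.
(* The equation differentiated with respect to ['X]; the derivative [d] of [F]
   is multiplied by the expression that vanishes at [u]. *)
have eD : (v - 1) + (u - 1) * d = tau * x * w + tau * u * (z * d) * w
    + tau * u * x * (v + (u - 1) * d + z * d).
  have /(congr1 (fun p : {poly A} => p^`().[u])) := eqF.
  rewrite /= !derivE !hornerE /= -/d -/v -/g -/x => eD.
  by rewrite subr0 -/w in eD; rewrite eD; ring.
have def_x : x = 1 + z * (v - 1) by [].
have def_w : w = (u - 1) * v + z * (v - g) by [].
rewrite -/g; clearbody g x w v d; clear X W def_u.
have eV : v - 1 = tau * u ^+ 2 * x * v.
  have -> : v - 1 = u * ((v - 1) + (u - 1) * d) - (u - 1) * (v - 1)
                    - u * (u - 1) * d by ring.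
  by rewrite eD eP [in X in _ - X]eK; ring.
have eU : u - 1 = tau * u * x ^+ 2 * (u - 1 + z).
  rewrite [LHS](_ : _ = x * (u - 1) - z * ((u - 1) * (v - 1))); last first.
    by rewrite def_x; ring.
  by rewrite eP {1}eK; ring.
(* The difference of the two sides is [tau] times a multiple of itself. *)
have def_u : u - 1 = z * (v - 1).
  apply/subr0_eq/(@nilpotent_contraction _ tau (u * x * (1 - z)) _ N nil_tau).
  by rewrite {1}eU {1}eV def_x; ring.
have eq_xu : x = u by rewrite def_x -def_u addrC subrK.
have eq_y : u - 1 = y.
  apply/subr0_eq.
  have [c] := horner_sub_dvd (('X + 1) ^+ 3 * ('X + z%:P)) (u - 1) y.
  rewrite !hornerE => def_c.
  apply: (@nilpotent_contraction _ tau c _ N nil_tau).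
  by rewrite -mulrA -def_c {1}eU {1}def_y eq_xu; ring.
(* A factor [u] can be cancelled because [u - 1] is a multiple of [tau]. *)
have eW : tau * (z * w - u * y * (y + z)) = 0.
  apply: (@nilpotent_contraction _ tau (- (u ^+ 3 * (u - 1 + z))) _ N nil_tau).
  have: tau * u * (z * w - u * y * (y + z)) = 0.
    rewrite -eq_y; apply/eqP; rewrite -subr_eq0 subr0; apply/eqP.
    have -> : tau * u * (z * w - u * (u - 1) * (u - 1 + z))
      = tau * (u * (z * w + x * (u - 1 + z))) - tau * u * x ^+ 2 * (u - 1 + z).
      by rewrite eq_xu; ring.
    by rewrite -eK -eU subrr.
  have -> : tau * u * (z * w - u * y * (y + z)) =
    tau * (z * w - u * y * (y + z)) + (u - 1) * (tau * (z * w - u * y * (y + z))).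
    by ring.
  by move/eqP; rewrite addr_eq0 => /eqP {1}->; rewrite {1}eU eq_xu; ring.
have def_v : z * v = y + z by rewrite -eq_y def_u; ring.
have def_u1 : u = 1 + y by rewrite -eq_y; ring.
have -> : z ^+ 2 * g = (y + z) * (z * v) - z * w.
  by rewrite def_w -eq_y; ring.
apply/eqP; rewrite -subr_eq0 -oppr0 -eW def_v def_u1; apply/eqP; ring.
Qed.

(** * Lagrange inversion *)

Lemma coef_dvdpXn (K : fieldType) (p : {poly K}) N i :
  'X^N %| p -> (i < N)%N -> p`_i = 0.
Proof. by case/dvdpP=> q -> lt_iN; rewrite coefMXn lt_iN. Qed.

Lemma dvdp_deriv_Xn (K : fieldType) (p : {poly K}) N :
  'X^(N.+1) %| p -> 'X^N %| p^`().
Proof.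
case/dvdpP=> q ->; rewrite derivM derivXn mulrnAr -mulrnAl.
by rewrite exprS mulrA dvdp_add // dvdp_mulIr.
Qed.

(** Coefficients that vanish identically, because the Euler operator multiplies
the coefficient of degree [k] by [k]; identities between coefficients are proved
by adding them. *)
Lemma coef_euler (R : nzRingType) (p : {poly R}) k :
  ('X * p^`() - p *+ k)`_k = 0.
Proof.
rewrite coefB coefXM coefMn; case: k => [|k] /=; first by rewrite subrr.
by rewrite coef_deriv subrr.
Qed.

(** The derivative of [a * w ^ m], where [w = 'X / phi], cleared of its
denominators. *)
Lemma lagrange_term (R : comNzRingType) (phi : {poly R}) (a : R) m k :
  phi * (a%:P * ('X^m * phi ^+ k.+1))^`()
    - (m + k.+1)%:R * phi^`() * (a%:P * ('X^m * phi ^+ k.+1))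
  = phi * ((a *+ m)%:P * ('X^(m.-1) * phi ^+ k.+1 - 'X^m * (phi^`() * phi ^+ k))).
Proof.
rewrite derivM [('X^m * _)^`()]derivM derivC derivXn deriv_exp mul0r add0r.
rewrite polyCMn -(mulr_natr a%:P) -(mulr_natr 'X^(m.-1)).
rewrite -(mulr_natr (_ * _)) natrD.
by case: m => [|m]; rewrite /= !exprS; ring.
Qed.

(** With [w = 'X / phi], the hypothesis says that [H] is the sum of the
[g m * w ^ m] up to terms of high degree, after multiplication by
[phi ^+ n.+1] to avoid quotients.  The proof is the residue argument: the residue
of [w ^ j * w'] vanishes unless [j = -1]. *)
Lemma lagrange_inversion (K : numFieldType) (phi H : {poly K}) (g : nat -> K) n :
    coprimep phi 'X ->
    'X^(n.+2) %| \sum_(m < n.+2) (g m)%:P * ('X^m * phi ^+ (n.+1 - m))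
               - H * phi ^+ n.+1 ->
  (H^`() * phi ^+ n.+1)`_n = g n.+1 *+ n.+1.
Proof.
move=> co_phi; set S := \sum_(m < _) _ => dvdS.
pose Q (m : nat) := 'X^(m.-1) * phi ^+ (n.+1 - m)
                    - 'X^m * (phi^`() * phi ^+ (n - m)).
pose E := \sum_(m < n.+1) (g m *+ m)%:P * Q m
          + (g n.+1 *+ n.+1)%:P * 'X^n - H^`() * phi ^+ n.+1.
have dvdE : 'X^(n.+1) %| E.
  have co : coprimep 'X^(n.+1) phi by rewrite coprimep_expl // coprimep_sym.
  rewrite -(Gauss_dvdpr _ co).
  (* Differentiating the hypothesis and eliminating [H] by the hypothesis itself
     leaves a multiple of [phi], except in the term of index [n.+1], whose part with
     [phi^`()] has degree too high to matter. *)
  have -> : phi * E = phi * (S - H * phi ^+ n.+1)^`()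
      - n.+1%:R * phi^`() * (S - H * phi ^+ n.+1)
      + 'X^(n.+1) * ((g n.+1 *+ n.+1)%:P * phi^`()).
    rewrite /S big_ord_recr /= subnn expr0 mulr1 /E.
    set S1 := \sum_(m < n.+1) (g m)%:P * ('X^m * phi ^+ (n.+1 - m)).
    set S2 := \sum_(m < n.+1) (g m *+ m)%:P * Q m.
    have dS : phi * S1^`() - n.+1%:R * phi^`() * S1 = phi * S2.
      rewrite /S1 /S2 raddf_sum !mulr_sumr -sumrB.
      apply: eq_bigr => -[m /= le_mn] _; rewrite /Q subSn // -lagrange_term.
      by rewrite -subSn // subnKC // ltnW.
    have -> : phi * (S2 + (g n.+1 *+ n.+1)%:P * 'X^n - H^`() * phi ^+ n.+1)
        = phi * S2 + phi * ((g n.+1 *+ n.+1)%:P * 'X^n - H^`() * phi ^+ n.+1).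
      by ring.
    rewrite -dS derivB derivD (derivM H) (derivM (g _)%:P) derivC derivXn deriv_exp.
    rewrite /= polyCMn.
    rewrite -(mulr_natr (g _)%:P) -(mulr_natr 'X^n) -(mulr_natr (_ * _)) !exprS.
    by ring.
  apply: dvdp_add; last exact: dvdp_mulIl.
  apply: dvdp_sub; first exact/dvdp_mull/dvdp_deriv_Xn.
  by apply/dvdp_mull/(dvdp_trans _ dvdS)/dvdp_exp2l.
have := coef_dvdpXn dvdE (ltnSn n).
rewrite /E coefB coefD coef_sum big1 => [|[m /= le_mn] _].
  by rewrite add0r coefCM coefXn eqxx mulr1 => /subr0_eq.
case: m le_mn => [|m] le_mn; first by rewrite mulr0n mul0r coef0.
have lt_mn : (m < n)%N by [].
rewrite coefCM /Q coefB /= !coefXnM [in X in X - _]ltnNge (ltnW lt_mn) /=.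
rewrite ltnS leqNgt lt_mn /=.
have -> : (n.+1 - m.+1)%N = (n - m.+1).+1 by rewrite subSn.
have -> : (n - m = (n - m.+1).+1)%N by rewrite subnSK.
set k := (n - m.+1)%N.
have := coef_euler (phi ^+ k.+1) k.+1.
rewrite deriv_exp coefB coefMn coefXM /= coefMn => /subr0_eq/eqP.
rewrite -subr_eq0 -mulrnBl mulrn_eq0 /= subr_eq0 mulrC => /eqP->.
by rewrite subrr mulr0.
Qed.

(** * A coefficient identity *)

(** The two sides differ by a combination of coefficients of the form of
[coef_euler], that is, by the coefficient of a total derivative. *)
Lemma coef_total_derivative (K : numFieldType) (z : K) m :
  let Z := z%:P in
  (((3 * m + 4) * (3 * m + 5))%:R : K)
    * (((Z - 2 * Z * 'X - 3 * 'X^2) * ((1 + 'X) ^+ 3 * (Z + 'X)) ^+ m.+1)`_m)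
  = ((2 * m.+1)%:R * z ^+ 2)
    * ((1 + 'X) ^+ (3 * m + 5) * (Z + 'X) ^+ m)`_m.+2.
Proof.
move=> Z; pose a : K := m%:R.
(* The cubic [C] is the solution of the linear system that expresses the identity
   [dR] below. *)
pose c0 := - 2 * (a + 1) * z; pose c1 := 2 - (8 * a + 12) * z.
pose c2 := (3 * a + 4) * ((3 * a + 5) * z - 2).
pose c3 := (3 * a + 4) * (3 * a + 5).
pose C : {poly K} := c0%:P + c1%:P * 'X + c2%:P * 'X^2 + c3%:P * 'X^3.
pose R := C * ((1 + 'X) ^+ (3 * m + 4) * (Z + 'X) ^+ m.+1).
pose P1 := (1 + 'X) ^+ (3 * m + 5) * (Z + 'X) ^+ m.
pose P2 := (Z - 2 * Z * 'X - 3 * 'X^2) * ((1 + 'X) ^+ 3 * (Z + 'X)) ^+ m.+1.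
have dC : C^`() = c1%:P + 2 * c2%:P * 'X + 3 * c3%:P * 'X^2.
  by rewrite /C !(derivD, derivM, derivC, derivXn, derivX) /=; ring.
have dR : 'X * R^`() - R *+ m.+2
    = (a + 2)%:P * (((2 * m.+1)%:R * z ^+ 2)%:P * P1
        - (((3 * m + 4) * (3 * m + 5))%:R)%:P * ('X^2 * P2)).
  pose k := (3 * m.+1)%N.
  have e4 : (3 * m + 4 = k.+1)%N by rewrite /k; lia.
  have e5 : (3 * m + 5 = k.+2)%N by rewrite /k; lia.
  have ka : k%:R = 3 * (a + 1) :> K by rewrite /k natrM -[m.+1%:R]natr1.
  rewrite /R /P1 /P2 e4 e5 derivM dC derivM.
  rewrite (deriv_exp (1 + 'X)) (deriv_exp (Z + 'X)).
  rewrite !derivD derivX !derivC /= add0r !mul1r.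
  rewrite exprMn -exprM -/k; clearbody k.
  rewrite -(mulr_natr (_ ^+ k)) -(mulr_natr (_ ^+ m)) -(mulr_natr (C * _)).
  rewrite !exprS -!polyC_natr.
  rewrite !natrM -[k.+2%:R]natr1 -[k.+1%:R]natr1 -[m.+2%:R]natr1 -[m.+1%:R]natr1 ka.
  rewrite /C /c0 /c1 /c2 /c3 /Z -/a; ring.
have /eqP := coef_euler R m.+2.
rewrite dR coefCM mulf_eq0 => /orP[|].
  by rewrite /a -natrD pnatr_eq0 addn2.
by rewrite coefB !coefCM coefXnM /= !subSS subn0 subr_eq0 => /eqP.
Qed.

(** * Counting weighted intervals *)

Definition weighted_intervals (z n : nat) : nat :=
  (\sum_(I in intervals n) z ^ (des I.1 + asc I.2))%N.

Lemma weighted_intervalsE z n :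
  weighted_intervals z n
  = (\sum_(t <- bintrees_upto n | nodes t == n)
      \sum_(s <- lower t) z ^ (right_edges s + left_edges t))%N.
Proof.
transitivity (\sum_(s : tamari n) \sum_(t : tamari n)
    if (s, t) \in intervals n then z ^ (des s + asc t) else 0)%N.
  rewrite /weighted_intervals big_mkcond pair_bigA.
  by apply: eq_bigr => -[s t] _.
rewrite exchange_big /= -[RHS]big_filter.
rewrite -(@big_tamari n _ (fun t =>
  \sum_(s <- lower t) z ^ (right_edges s + left_edges t))%N); first last.
- by move=> t; rewrite mem_filter => /andP[/eqP].
- by rewrite filter_uniq ?bintrees_upto_uniq.
rewrite [RHS](eq_bigl predT) => [|t]; last first.
  by rewrite mem_filter nodes_tamari eqxx mem_bintrees_upto ?nodes_tamari.
apply: eq_bigr => t _; rewrite -(@big_tamari n _ (fun s =>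
  z ^ (right_edges s + left_edges t))%N) ?uniq_lower //; last first.
  by move=> s /lower_below/below_nodes->; apply: nodes_tamari.
rewrite -big_mkcond /=; apply: eq_big => s; first by rewrite inE tamari_le_lower.
by rewrite desE ascE.
Qed.

Lemma interval_gf_horner1 (A : comNzRingType) (tau : A) (z h : nat) :
    tau ^+ h.+1 = 0 ->
  (interval_gf z%:R tau h).[1]
  = \sum_(m < h.+1) tau ^+ m * (weighted_intervals z m)%:R.
Proof.
move=> nil_tau.
pose W t := (\sum_(s <- lower t) z ^ (right_edges s + left_edges t))%N.
have term t : ((upper_wt z%:R tau t)%:P * lower_gf z%:R t).[1]
    = tau ^+ nodes t * (W t)%:R.
  rewrite hornerM hornerC /upper_wt -mulrA; congr (_ * _).
  rewrite /lower_gf horner_sum /W natr_sum mulr_sumr; apply: eq_bigr => s _.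
  by rewrite /lower_wt hornerM hornerC hornerXn expr1n mulr1 natrX exprD mulrC.
rewrite /interval_gf horner_sum; under eq_bigr do rewrite term.
(* Both enumerations contain all trees with [m] nodes. *)
have trees_of m : (m <= h)%N -> weighted_intervals z m
    = (\sum_(t <- bintrees_upto h | nodes t == m) W t)%N.
  move=> le_mh; rewrite weighted_intervalsE -big_filter -[RHS]big_filter.
  apply: perm_big; apply: uniq_perm; rewrite ?filter_uniq ?bintrees_upto_uniq //.
  move=> t; rewrite !mem_filter; apply: andb_id2l => /eqP def_m.
  by rewrite !mem_bintrees_upto ?def_m.
under [RHS]eq_bigr => m _ do
  rewrite trees_of -1?ltnS // natr_sum mulr_sumr big_mkcond.
rewrite exchange_big /=; apply: eq_bigr => t _.
rewrite -big_mkcond /=; have [le_th | lt_ht] := leqP (nodes t) h.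
  by rewrite (big_pred1 (Ordinal (le_th : nodes t < h.+1)%N)).
rewrite big1 => [|m /eqP def_m]; last by have := ltn_ord m; lia.
by rewrite -(subnKC lt_ht) exprD nil_tau !mul0r.
Qed.

Lemma in_qpoly_Xn_eq0 (K : fieldType) N (p : {poly K}) :
  in_qpoly 'X^(N.+1) p = 0 -> 'X^(N.+1) %| p.
Proof.
move/(congr1 val) => /=; rewrite mk_monic_Xn /= -Pdiv.IdomainMonic.modpE ?monicXn //.
by move=> mod0; apply/modp_eq0P.
Qed.

Lemma in_qpoly_Xn (K : fieldType) N :
  (in_qpoly 'X^(N.+1) 'X : {poly %/ ('X^(N.+1) : {poly K})}) ^+ N.+1 = 0.
Proof.
rewrite -rmorphXn /=; apply: val_inj => /=.
rewrite mk_monic_Xn /= -Pdiv.IdomainMonic.modpE ?monicXn //.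
exact: modpp.
Qed.

(** The kernel takes the value [z] at [0]; this is where [z > 0] is needed. *)
Lemma coprimep_kernel (K : numFieldType) (z : nat) :
  (0 < z)%N -> coprimep ((1 + 'X) ^+ 3 * (z%:R + 'X) : {poly K}) 'X.
Proof.
move=> z_gt0; rewrite coprimepX rootE (_ : _.[0] = z%:R) ?pnatr_eq0 -?lt0n //.
by rewrite addrC -polyC_natr !hornerE; ring.
Qed.

(** The solution of the catalytic equation, transported to polynomials. It
applies to a morphism [pi] that kills a power of ['X] and makes the kernel
[phi] invertible: then [tau = 'X / phi] is nilpotent, and ['X] is the required
solution [y]. *)
Lemma weighted_intervals_nilpotent (R A : comNzRingType)
    (pi : {rmorphism {poly R} -> A}) (z m : nat) (ipsi : A) :
  let phi : {poly R} := (1 + 'X) ^+ 3 * (z%:R + 'X) in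
    pi 'X ^+ m.+3 = 0 -> ipsi * pi phi = 1 ->
  pi ('X * (\sum_(k < m.+2) (z%:R ^+ 2 * (weighted_intervals z k)%:R)%:P
              * ('X^k * phi ^+ (m.+1 - k))
            - ('X + z%:R) * (z%:R - 'X^2) * phi ^+ m.+1)) = 0.
Proof.
move=> phi; set y := pi 'X => nil_y inv_phi; pose tau := y * ipsi.
have nil_tau : tau ^+ m.+3 = 0 by rewrite exprMn nil_y mul0r.
have pi_phi : pi phi = (1 + y) ^+ 3 * (y + z%:R).
  rewrite /phi rmorphM rmorphXn !rmorphD rmorph1 rmorph_nat -/y.
  by ring.
have tau_phi : tau * pi phi = y by rewrite -mulrA inv_phi mulr1.
have def_y : y = tau * ((1 + y) ^+ 3 * (y + z%:R)) by rewrite -pi_phi tau_phi.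
clearbody phi; have := interval_gfS z%:R tau m.+2.
rewrite /= (interval_gf_stable _ nil_tau) => eqF.
have := catalytic_solution nil_tau eqF def_y.
rewrite interval_gf_horner1 // big_ord_recr /=.
move/(congr1 (fun a => a * pi phi ^+ m.+2)).
set S := \sum_(k < _) _ => eqS.
have top : tau * tau ^+ m.+2 = 0 by rewrite -exprS.
have scale k : (k <= m.+1)%N ->
    tau * tau ^+ k * pi phi ^+ m.+2 = y * pi ('X^k * phi ^+ (m.+1 - k)).
  move=> le_k.
  have -> : pi phi ^+ m.+2 = pi phi ^+ (m.+1 - k) * pi phi ^+ k.+1.
    by rewrite -exprD; congr (_ ^+ _); lia.
  rewrite -exprS mulrCA -exprMn tau_phi rmorphM [pi 'X^k]rmorphXn -/y.
  by rewrite [pi (phi ^+ _)]rmorphXn exprS; ring.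
have eqL : tau * (z%:R ^+ 2 * (S + tau ^+ m.+2 * (weighted_intervals z m.+2)%:R))
      * pi phi ^+ m.+2
    = y * pi (\sum_(k < m.+2) (z%:R ^+ 2 * (weighted_intervals z k)%:R)%:P
                               * ('X^k * phi ^+ (m.+1 - k))).
  rewrite (_ : _ * _ = z%:R ^+ 2 * (tau * S * pi phi ^+ m.+2)
    + z%:R ^+ 2 * (weighted_intervals z m.+2)%:R * pi phi ^+ m.+2
      * (tau * tau ^+ m.+2)); last by ring.
  rewrite top mulr0 addr0 /S rmorph_sum [tau * _]mulr_sumr mulr_suml !mulr_sumr.
  apply: eq_bigr => -[k /= lt_k] _.
  rewrite [in RHS]rmorphM [in RHS]mulrCA -scale //.
  have -> : pi (z%:R ^+ 2 * (weighted_intervals z k)%:R)%:P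
      = z%:R ^+ 2 * (weighted_intervals z k)%:R.
    by rewrite -natrX -natrM polyC_natr rmorph_nat natrM natrX.
  by ring.
have eqR : tau * ((y + z%:R) * (z%:R - y ^+ 2)) * pi phi ^+ m.+2
    = y * pi (('X + z%:R) * (z%:R - 'X^2) * phi ^+ m.+1).
  rewrite !rmorphM rmorphD rmorphB !rmorph_nat [pi 'X^2]rmorphXn.
  rewrite [pi (phi ^+ _)]rmorphXn -/y.
  rewrite [LHS](_ : _ = tau * pi phi
    * ((y + z%:R) * (z%:R - y ^+ 2) * pi phi ^+ m.+1)); last first.
    by rewrite [pi phi ^+ m.+2]exprS; ring.
  by rewrite tau_phi; ring.
rewrite mulrBr rmorphB (rmorphM _ 'X) -/y -eqL (rmorphM _ 'X) -/y -eqR.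
by rewrite eqS subrr.
Qed.

(** The division by ['X], which stands for the factor [tau] in
[catalytic_solution], costs one degree of precision. *)
Lemma weighted_intervals_param (K : numFieldType) (z m : nat) :
    (0 < z)%N ->
  ('X^(m.+2) : {poly K})
    %| \sum_(k < m.+2) (z%:R ^+ 2 * (weighted_intervals z k)%:R)%:P
        * ('X^k * ((1 + 'X) ^+ 3 * (z%:R + 'X)) ^+ (m.+1 - k))
      - ('X + z%:R) * (z%:R - 'X^2) * ((1 + 'X) ^+ 3 * (z%:R + 'X)) ^+ m.+1.
Proof.
move=> z_gt0; have co_phi := @coprimep_kernel K z z_gt0.
have /Bezout_eq1_coprimepP[[psi e] /= bezout] := coprimep_expr m.+3 co_phi.
pose pi : {rmorphism {poly K} -> {poly %/ ('X^(m.+3) : {poly K})}} :=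
  in_qpoly 'X^(m.+3).
have nil_y : pi 'X ^+ m.+3 = 0 := in_qpoly_Xn K m.+2.
have inv_phi : pi psi * pi ((1 + 'X) ^+ 3 * (z%:R + 'X)) = 1.
  have := congr1 pi bezout; rewrite rmorphD (rmorphM _ e) rmorphXn nil_y.
  by rewrite mulr0 addr0 rmorphM rmorph1.
have := in_qpoly_Xn_eq0 (weighted_intervals_nilpotent nil_y inv_phi).
by rewrite exprS dvdp_mul2l // polyX_eq0.
Qed.

Lemma weighted_intervals_coef (K : numFieldType) (z m : nat) :
    (0 < z)%N ->
  ((3 * m + 4) * (3 * m + 5))%:R * (weighted_intervals z m.+1)%:R
  = 2 * ((1 + 'X) ^+ (3 * m + 5) * (z%:R + 'X) ^+ m)`_m.+2 :> K.
Proof.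
move=> z_gt0; pose Z : {poly K} := z%:R.
pose phi := (1 + 'X) ^+ 3 * (Z + 'X).
have co_phi : coprimep phi 'X by exact: coprimep_kernel.
pose g k : K := z%:R ^+ 2 * (weighted_intervals z k)%:R.
have := @lagrange_inversion _ phi _ g m co_phi (weighted_intervals_param K m z_gt0).
have -> : (('X + Z) * (Z - 'X^2))^`() = Z - 2 * Z * 'X - 3 * 'X^2.
  rewrite derivM derivB derivD derivX derivXn /Z -!polyC_natr !derivC /=.
  by rewrite -(mulr_natr 'X); ring.
move=> lag; have := coef_total_derivative (z%:R : K) m.
rewrite /= polyC_natr -/Z -/phi lag -mulr_natr => eq_z.
have nz : (m.+1%:R * z%:R ^+ 2 : K) != 0.
  by rewrite mulf_neq0 ?expf_neq0 ?pnatr_eq0 -?lt0n.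
apply: (mulfI nz); move: eq_z; rewrite [(2 * m.+1)%:R]natrM => eq_z.
rewrite (_ : _ * (2 * _) = 2 * m.+1%:R * z%:R ^+ 2
   * ((1 + 'X) ^+ (3 * m + 5) * (Z + 'X) ^+ m)`_m.+2); last by ring.
by rewrite -eq_z /g; ring.
Qed.

(** With [z = q + 1], the factor [z + 'X] is [(1 + 'X) + q], so that the
binomial formula leaves only powers of [1 + 'X]. *)
Lemma coef_shifted_product (R : comNzRingType) (q : R) m :
  ((1 + 'X) ^+ (3 * m + 5) * ((q + 1)%:P + 'X) ^+ m)`_m.+2
  = \sum_(k < m.+1) ('C(m, k) * 'C(4 * m + 5 - k, m.+2))%:R * q ^+ k.
Proof.
have coef_1X N i : ((1 + 'X) ^+ N : {poly R})`_i = 'C(N, i)%:R.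
  rewrite addrC exprD1n coef_sum.
  under eq_bigr do rewrite coefMn coefXn.
  have [lt_iN | le_Ni] := ltnP i N.+1.
    rewrite (bigD1 (Ordinal lt_iN)) //= eqxx big1 ?addr0 // => j.
    by rewrite -val_eqE /= eq_sym => /negbTE->; rewrite mul0rn.
  rewrite bin_small // big1 // => j _.
  by rewrite gtn_eqF ?mul0rn // (leq_trans (ltn_ord j)).
have -> : (q + 1)%:P + 'X = (1 + 'X) + q%:P :> {poly R}.
  by rewrite polyCD; ring.
rewrite [(_ + q%:P) ^+ m]exprDn mulr_sumr coef_sum; apply: eq_bigr => -[k /= le_k] _.
rewrite mulrnAr mulrA -exprD -polyC_exp coefMn coefMC coef_1X natrM.
have -> : (3 * m + 5 + (m - k) = 4 * m + 5 - k)%N by lia.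
by rewrite -mulr_natr; ring.
Qed.

(** * Comparison of coefficients *)

(** Descents increase along the order, so [des s + asc t] is at most
[des t + asc t], the number of edges of [t]. *)
Lemma interval_des_asc n (s t : tamari n) :
  (0 < n)%N -> (s <= t)%O -> (des s + asc t < n)%N.
Proof.
rewrite tamari_le_lower desE ascE => n_gt0 /lower_below/below_right_edges.
by have := right_left_edges t; rewrite nodes_tamari; lia.
Qed.

Lemma b_sum_a n k : (0 < n)%N ->
  b_ n k = (\sum_(k <= l < n) a_ n l * 'C(l, k))%N.
Proof.
move=> n_gt0.
rewrite (big_nat_widenl k 0) // big_mkord big_mkcond /=.
transitivity (\sum_(l < n) a_ n l * 'C(l, k))%N; last first.
  by apply: eq_bigr => l _; case: leqP => // lt_lk; rewrite bin_small ?muln0.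
rewrite /b_ /a_; under [RHS]eq_bigr => l _ do
  rewrite -sum1_card big_distrl big_mkcond /=.
rewrite exchange_big big_mkcond /=; apply: eq_bigr => I _.
rewrite -big_mkcond; case: ifPn => [I_in | I_out].
  have lt_d : (des I.1 + asc I.2 < n)%N.
    by apply: interval_des_asc => //; rewrite inE in I_in.
  rewrite (big_pred1 (Ordinal lt_d)) ?mul1n // => l.
  by rewrite !inE in I_in *; rewrite I_in -val_eqE /= eq_sym.
by rewrite big1 // => l; rewrite inE (negbTE I_out).
Qed.

(** The binomial formula for [(1 + q) ^ (des s + asc t)]. *)
Lemma weighted_intervals_b q n : (0 < n)%N ->
  weighted_intervals q.+1 n = (\sum_(k < n) b_ n k * q ^ k)%N.
Proof.
move=> n_gt0; rewrite /weighted_intervals /b_.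
under [RHS]eq_bigr do rewrite big_distrl /=.
rewrite exchange_big /=; apply: eq_bigr => I; rewrite inE => le_I.
have lt_d := interval_des_asc n_gt0 le_I.
rewrite -add1n expnDn.
under [LHS]eq_bigr => k _ do rewrite exp1n mul1n.
rewrite (big_ord_widen n (fun k => 'C(des I.1 + asc I.2, k) * q ^ k)%N) //.
rewrite big_mkcond; apply: eq_bigr => k _.
by case: ltnP => // lt_dk; rewrite bin_small.
Qed.

Lemma poly_nat_roots (K : numFieldType) (p : {poly K}) :
  (forall q : nat, p.[q%:R] = 0) -> p = 0.
Proof.
move=> root_p; apply: (@roots_geq_poly_eq0 _ p [seq q%:R | q <- iota 0 (size p)]).
- by apply/allP=> _ /mapP[q _ ->]; rewrite rootE root_p.
- by rewrite map_inj_uniq ?iota_uniq //; apply: mulrIn; apply: oner_neq0.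
- by rewrite size_map size_iota.
Qed.

(** Both sides, as coefficients of polynomials in [q], agree because the
polynomials agree at all natural numbers. *)
Lemma b_closed_form (K : numFieldType) m k :
  ((3 * m + 4) * (3 * m + 5))%:R * (b_ m.+1 k)%:R
  = 2 * ('C(m, k) * 'C(4 * m + 5 - k, m.+2))%:R :> K.
Proof.
have [le_km | lt_mk] := leqP k m; last first.
  rewrite bin_small // mul0n mulr0 /b_ big1 ?mulr0 // => I; rewrite inE => le_I.
  by rewrite bin_small // (leq_trans (interval_des_asc _ le_I)).
pose lhs i : K := ((3 * m + 4) * (3 * m + 5))%:R * (b_ m.+1 i)%:R.
pose rhs i : K := 2 * ('C(m, i) * 'C(4 * m + 5 - i, m.+2))%:R.
have: \poly_(i < m.+1) (lhs i - rhs i) = 0.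
  apply: poly_nat_roots => q; rewrite horner_poly.
  have := weighted_intervals_coef K m (ltn0Sn q).
  rewrite weighted_intervals_b // natr_sum mulr_sumr.
  have -> : q.+1%:R = (q%:R + 1)%:P :> {poly K} by rewrite natr1 polyC_natr.
  rewrite coef_shifted_product mulr_sumr => eq_lr.
  under eq_bigr do rewrite mulrBl.
  rewrite sumrB; apply/eqP; rewrite subr_eq0; apply/eqP.
  rewrite /rhs; under [RHS]eq_bigr do rewrite -mulrA.
  rewrite -eq_lr; apply: eq_bigr => i _.
  by rewrite /lhs [(b_ _ _ * _)%:R]natrM natrX mulrA.
move/(congr1 (fun p : {poly K} => p`_k)).
by rewrite coef_poly coef0 ltnS le_km => /subr0_eq.
Qed.

Local Close Scope ring_scope.

Theorem theorem2 (n k : nat) (hn : 1 <= n) :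
  b_ n k = \sum_(k <= l < n) a_ n l * 'C(l, k) /\
  ((b_ n k)%:R =
     2%:R / ((3 * n + 1) * (3 * n + 2))%N%:R
       * 'C(n - 1, k)%:R * 'C(4 * n + 1 - k, n + 1)%:R :> rat)%R.
Proof.
split; first exact: b_sum_a.
case: n hn => // m _.
have -> : 3 * m.+1 + 1 = 3 * m + 4 by lia.
have -> : 3 * m.+1 + 2 = 3 * m + 5 by lia.
have -> : 4 * m.+1 + 1 - k = 4 * m + 5 - k by lia.
have nz : (((3 * m + 4) * (3 * m + 5))%:R != 0 :> rat)%R.
  by rewrite pnatr_eq0; lia.
rewrite subSS subn0 addn1.
by apply: (mulfI nz); rewrite b_closed_form -!mulrA [RHS]mulrCA mulVKf // (natrM _ 'C(m, k)).
Qed.
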